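(* For any $\alpha, \beta \in \mathbf{R}$ such that $0 < \alpha \leq \beta$ and any integer $k\ge 1$, there exists a compact metric space $X$ such that for every $a \in [\alpha,\beta]$, the homology group $\mathrm{H}_k(\mathrm{Rips}(X,a))$ has uncountable infinite dimension.
   Context: $\mathrm{H}_k$ is simplicial homology with coefficients in a fixed field $\mathbf{k}$; dimension is over $\mathbf{k}$. For a metric space $(X,d_X)$ and $a\in\mathbf{R}$, the Vietoris--Rips complex $\mathrm{Rips}(X,a)$ is the simplicial complex whose simplices are the nonempty finite subsets $\{x_0,\dots,x_k\}\subseteq X$ with $d_X(x_i,x_j)\le a$ for all $i,j$. *)

(* Defs.v *)
From HB Require Import structures.
From mathcomp Require Import all_boot all_order all_algebra.
From mathcomp Require Import finmap.
From mathcomp Require Import boolp classical_sets cardinality wochoice reals.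
From mathcomp Require Import topology.
From mathcomp Require Import monalg.

Set Implicit Arguments.
Unset Strict Implicit.
Unset Printing Implicit Defensive.

Import Order.TTheory GRing.Theory Num.Theory.

Local Open Scope fset_scope.
Local Open Scope classical_set_scope.
Local Open Scope ring_scope.

Record simplicial_complex (T : choiceType) := SimplicialComplex {
  simplex : set {fset T};
  simplex_neq0 : forall s, simplex s -> s != fset0;
  simplex_face : forall s t, simplex s -> (t `<=` s)%fset -> t != fset0 ->
    simplex t }.

Section Rips.
Variables (R : realType) (X : metricType R) (a : R).

Definition rips_simplex : set {fset X} :=
  [set s | s != fset0 /\ forall x y, x \in s -> y \in s -> mdist x y <= a].

Fact rips_simplex_neq0 s : rips_simplex s -> s != fset0.
Proof. by case. Qed.

Fact rips_simplex_face s t :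
  rips_simplex s -> (t `<=` s)%fset -> t != fset0 -> rips_simplex t.
Proof.
by move=> [_ ds] /fsubsetP ts t0; split=> // x y /ts xs /ts ys; apply: ds.
Qed.

Definition Rips : simplicial_complex X :=
  SimplicialComplex rips_simplex_neq0 rips_simplex_face.

End Rips.

(* The quotient of a module by a submodule: the library provides the abelian
   group {quot W}; only the scaling is added here. *)
Section QuotientModule.
Variables (F : fieldType) (V : lmodType F) (W : {pred V}).
Hypothesis W_submod : submod_closed W.
Local Open Scope quotient_scope.

Definition submod_zmodClosed : zmodClosed V :=
  HB.pack_for (zmodClosed V) (W : V -> bool)
    (GRing.isZmodClosed.Build V W (GRing.subsemimod_closedB W_submod)).

Local Notation Q := (Quotient.quot submod_zmodClosed).

Definition quot_mod : Type := Q.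
HB.instance Definition _ := GRing.Zmodule.on quot_mod.

Definition quot_scale (c : F) (u : quot_mod) : quot_mod :=
  \pi_Q (c *: repr (u : Q)).

Fact quot_scale_pi (c : F) (v : V) : quot_scale c (\pi_Q v) = \pi_Q (c *: v).
Proof.
apply/eqP; rewrite /quot_scale -Quotient.idealrBE -scalerBr.
apply: (GRing.subsemimod_closedZ W_submod).
suff: repr (\pi_Q v) - v \in submod_zmodClosed by [].
by rewrite Quotient.idealrBE reprK.
Qed.

Fact quot_scaleA c d u : quot_scale c (quot_scale d u) = quot_scale (c * d) u.
Proof. by rewrite -[u](@reprK _ Q) !quot_scale_pi scalerA. Qed.

Fact quot_scale1 : left_id 1 quot_scale.
Proof. by move=> u; rewrite -[u](@reprK _ Q) quot_scale_pi scale1r. Qed.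

Fact quot_scaleDr : right_distributive quot_scale +%R.
Proof.
move=> c u w; rewrite -[u](@reprK _ Q) -[w](@reprK _ Q).
by rewrite -(raddfD \pi_Q) !quot_scale_pi scalerDr raddfD.
Qed.

Fact quot_scaleDl u : {morph quot_scale^~ u : c d / c + d}.
Proof.
by move=> c d; rewrite -[u](@reprK _ Q) !quot_scale_pi scalerDl raddfD.
Qed.

HB.instance Definition _ := GRing.Zmodule_isLmodule.Build F quot_mod
  quot_scaleA quot_scale1 quot_scaleDr quot_scaleDl.

Definition quot_pi (v : V) : quot_mod := \pi_Q v.

Fact quot_pi_is_linear : linear quot_pi.
Proof.
move=> c v w; transitivity (\pi_Q (c *: v) + \pi_Q w); first exact: raddfD.
by rewrite -quot_scale_pi.
Qed.

HB.instance Definition _ :=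
  GRing.isLinear.Build F V quot_mod _ quot_pi quot_pi_is_linear.

Fact quot_pi_surj (u : quot_mod) : exists v, quot_pi v = u.
Proof. by exists (repr (u : Q)); apply: reprK. Qed.

Fact quot_pi_eq0 (v : V) : (quot_pi v == 0) = (v \in W).
Proof.
have := Quotient.idealrBE submod_zmodClosed v 0.
by rewrite subr0 -[RHS]/(quot_pi v == quot_pi 0) linear0.
Qed.

End QuotientModule.

(* Simplices are oriented by a total order on the vertices, namely the
   well-order provided by choice; homology does not depend on this order, up to
   isomorphism. *)
Definition vertex_order (T : choiceType) : rel T :=
  sval (well_ordering_principle T).

Definition vertex_pos (T : choiceType) (s : {fset T}) (x : T) : nat :=
  #|` [fset y in s | (y != x) && vertex_order y x] |.

Fact vertex_order_total (T : choiceType) : total (@vertex_order T).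
Proof.
apply: in2T; apply: (@wo_chainW _ _ predT) => A _.
by rewrite /vertex_order; case: well_ordering_principle => r; apply.
Qed.

Fact vertex_order_antisym (T : choiceType) : antisymmetric (@vertex_order T).
Proof.
apply: in2T; apply: (@wo_chain_antisymmetric _ _ predT) => A _.
by rewrite /vertex_order; case: well_ordering_principle => r; apply.
Qed.

Section Homology.
Variables (F : fieldType) (T : choiceType) (S : simplicial_complex T).

Local Notation chain := {malg F[{fset T}]}.

Definition is_simplex_of_dim (n : nat) (s : {fset T}) : Prop :=
  simplex S s /\ #|` s| = n.+1.

Definition chains (n : nat) : {pred chain} :=
  fun c => `[< forall s, s \in msupp c -> is_simplex_of_dim n s >].

(* If x_0 < ... < x_n are the vertices of s and x = x_i then vertex_pos s x = i,
   so this is the alternating sum of the faces of s. The empty set is not a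
   simplex, whence the condition, which only matters for n = 0. *)
Definition simplex_boundary (s : {fset T}) : chain :=
  \sum_(x <- s | (s `\ x)%fset != fset0)
    (-1) ^+ vertex_pos s x *: << (s `\ x)%fset >>.

Definition boundary (c : chain) : chain :=
  \sum_(s <- msupp c) c@_s *: simplex_boundary s.

Fact boundaryEw (d : {fset {fset T}}) c : (msupp c `<=` d)%fset ->
  boundary c = \sum_(s <- d) c@_s *: simplex_boundary s.
Proof.
move=> cd; rewrite /boundary (big_fset_incl _ cd)// => s _ sc.
by rewrite mcoeff_outdom// scale0r.
Qed.

Fact boundary_is_linear : linear boundary.
Proof.
move=> a c d; pose D := (msupp (a *: c + d) `|` (msupp c `|` msupp d))%fset.
rewrite (@boundaryEw D (a *: c + d)) ?fsubsetUl//.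
rewrite (@boundaryEw D c); last first.
  by rewrite (fsubset_trans (fsubsetUl _ (msupp d)))// fsubsetUr.
rewrite (@boundaryEw D d); last first.
  by rewrite (fsubset_trans (fsubsetUr (msupp c) _))// fsubsetUr.
rewrite scaler_sumr -big_split/=; apply: eq_bigr => s _.
by rewrite mcoeffD mcoeffZ scalerDl scalerA.
Qed.

HB.instance Definition _ :=
  GRing.isLinear.Build F chain chain _ boundary boundary_is_linear.

Fact boundaryU s : boundary << s >> = simplex_boundary s.
Proof.
rewrite (@boundaryEw [fset s]%fset) ?msuppU_le//.
by rewrite big_seq_fset1 mcoeffU eqxx scale1r.
Qed.

Let lt (x y : T) := (x != y) && vertex_order x y.

Let ltNge x y : x != y -> lt y x = ~~ lt x y.
Proof.
move=> xy; rewrite /lt xy eq_sym xy/=; apply/idP/idP.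
  by move=> yx; apply: contra xy => xy; apply/eqP/vertex_order_antisym/andP.
by have /orP[->//|->] := vertex_order_total x y.
Qed.

Let vertex_posD1 s x y : x \in s -> x != y ->
  vertex_pos s y = (lt x y + vertex_pos (s `\ x)%fset y)%N.
Proof.
move=> xs xy; rewrite /vertex_pos (cardfsD1 x) !inE xs/=; congr (_ + #|` _|)%N.
by apply/fsetP => z; rewrite !inE; case: eqP => //= ->.
Qed.

Fact chains_submod_closed n : submod_closed (chains n).
Proof.
split=> [|a c d /asboolP cn /asboolP dn]; first by apply/asboolP=> s; rewrite msupp0.
apply/asboolP => s; rewrite -mcoeff_neq0 mcoeffD mcoeffZ => acd.
have [/cn //|sc] := boolP (s \in msupp c).
have [/dn //|sd] := boolP (s \in msupp d).
by rewrite !mcoeff_outdom// mulr0 addr0 eqxx in acd.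
Qed.

Fact boundary_boundary c : boundary (boundary c) = 0.
Proof.
rewrite {2}/boundary linear_sum big1// => s _; rewrite linearZ/=.
suff -> : boundary (simplex_boundary s) = 0 by rewrite scaler0.
pose c0 x y := ((s `\ x) `\ y)%fset != fset0.
pose g x y : chain := (-1) ^+ (vertex_pos s x + vertex_pos (s `\ x)%fset y)
  *: << ((s `\ x) `\ y)%fset >>.
have -> : boundary (simplex_boundary s) =
    \sum_(x <- s) \sum_(y <- s | (x != y) && c0 x y) g x y.
  rewrite linear_sum/= big_seq_cond [RHS]big_seq big_mkcondr/=.
  apply: eq_bigr => x xs; case: ifPn => [sx|/negPn/eqP sx].
    rewrite linearZ/= boundaryU scaler_sumr.
    rewrite [RHS]big_mkcond (big_fsetD1 x xs)/= eqxx add0r -big_mkcond/=.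
    rewrite [LHS]big_seq_cond [RHS]big_seq_cond; apply: eq_big => y.
      by rewrite !inE /c0; case: (eqVneq y x) => //= [->|]; rewrite ?eqxx// eq_sym => ->.
    by move=> _; rewrite scalerA -exprD.
  rewrite big1// => y; rewrite /c0 sx => /andP[_]; rewrite (_ : _ `\ _ = fset0)%fset ?eqxx//.
  by apply/fsetP => z; rewrite !inE andbF.
have -> : \sum_(x <- s) \sum_(y <- s | (x != y) && c0 x y) g x y =
   \sum_(x <- s) \sum_(y <- s | lt x y && c0 x y) g x y +
   \sum_(x <- s) \sum_(y <- s | lt y x && c0 x y) g x y.
  rewrite -big_split/=; apply: eq_bigr => x _.
  rewrite (bigID (lt x))/=; congr (_ + _); apply: eq_bigl => y.
    by rewrite /lt; case: eqP => //=; case: vertex_order; rewrite ?andbT ?andbF.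
  case: (eqVneq x y) => [->|xy]; first by rewrite /lt eqxx.
  by rewrite (ltNge xy) andbC.
rewrite [X in _ + X](exchange_big_dep xpredT)//= -big_split/=.
rewrite big_seq big1// => x xs; rewrite [X in _ + X](eq_bigl (fun y => lt x y && c0 x y)); last first.
  by move=> y; rewrite /c0 !fsetDDl fsetUC.
rewrite -big_split/= big_seq_cond big1// => y /and3P[ys xy _].
have xny : x != y by case/andP: xy.
have Lyx : lt y x = false by rewrite ltNge// xy.
rewrite /g !fsetDDl (fsetUC [fset y]%fset) -scalerDl.
rewrite (vertex_posD1 xs xny) xy (@vertex_posD1 s y x) 1?eq_sym// Lyx.
by rewrite add0n add1n addSn exprS mulN1r addnC subrr scale0r.
Qed.

HB.instance Definition _ n :=
  GRing.isSubmodClosed.Build F chain (chains n) (chains_submod_closed n).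

Definition is_cycle (n : nat) : {pred chain} :=
  fun c => (c \in chains n) && (boundary c == 0).

Fact is_cycle_submod_closed n : submod_closed (is_cycle n).
Proof.
split=> [|a c d /andP[cn /eqP c0] /andP[dn /eqP d0]].
  by apply/andP; rewrite rpred0 linear0.
by apply/andP; rewrite rpredD ?rpredZ// linearP/= c0 d0 scaler0 addr0.
Qed.

HB.instance Definition _ n :=
  GRing.isSubmodClosed.Build F chain (is_cycle n) (is_cycle_submod_closed n).

Record cycles (n : nat) := Cycle {
  cycle_val :> chain;
  cycle_valP : cycle_val \in is_cycle n }.

HB.instance Definition _ n := [isSub for @cycle_val n].
HB.instance Definition _ n := [Choice of cycles n by <:].
HB.instance Definition _ n := [SubChoice_isSubLmodule of cycles n by <:].

Definition boundaries (n : nat) : {pred cycles n} :=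
  fun z => `[< exists2 b, b \in chains n.+1 & val z = boundary b >].

Fact boundaries_submod_closed n : submod_closed (@boundaries n).
Proof.
split=> [|a z w /asboolP[b bn zb] /asboolP[c cn wc]]; apply/asboolP.
  by exists 0; [exact: rpred0 | rewrite !linear0].
exists (a *: b + c); first by apply: rpredD => //; apply: rpredZ.
by rewrite (boundary_is_linear a b c) -zb -wc linearP.
Qed.

Definition homology (n : nat) : lmodType F := quot_mod (@boundaries_submod_closed n).

End Homology.

Section Dimension.
Variables (F : fieldType) (V : lmodType F).

Definition linearly_independent (B : set V) : Prop :=
  forall (s : {fset V}) (c : V -> F), [set` s] `<=` B ->
    \sum_(v <- s) c v *: v = 0 -> forall v, v \in s -> c v = 0.

Definition spanning (B : set V) : Prop :=
  forall v : V, exists (s : {fset V}) (c : V -> F),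
    [set` s] `<=` B /\ v = \sum_(w <- s) c w *: w.

Definition is_basis (B : set V) : Prop := linearly_independent B /\ spanning B.

Definition uncountable_dimension : Prop :=
  exists B : set V, is_basis B /\ ~ countable B.

End Dimension.

(* Main.v *)
Require Import Defs.
From HB Require Import structures.
From mathcomp Require Import all_boot all_order all_algebra.
From mathcomp Require Import finmap lra.
From mathcomp Require Import boolp classical_sets cardinality reals topology.
From mathcomp Require Import interval_inference.
From mathcomp Require normed_module lebesgue_measure.
From mathcomp Require Import monalg.

(** A simplex contained in no larger simplex never occurs in a boundary, so
    reading off its coefficient is a well-defined linear form on homology.
    Hence, to make [H_k] of uncountable dimension, it suffices to find
    uncountably many k-cycles [z_y] and maximal k-simplices [sigma_y] such that
    [z_y] has a nonzero coefficient on [sigma_y] and no [z_y'] with [y' <> y]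
    involves [sigma_y] ([uncountable_dimension_homology]).

    The space is [X = [alpha, beta] x [0, 1] x V], where [V] is the set of the
    2(k+1) vertices of the (k+1)-dimensional cross-polytope, i.e. of the pairs
    [(i, b)] with [i <= k] and [b] a sign. With [delta] the l1 distance on the
    base [[alpha, beta] x [0, 1]], the distance from [(r, y, v)] to
    [(r', y', v')] is [delta ((r, y), (r', y'))] plus
    - [|r - r'|] if [v = v'];
    - [max (r, r')] if [v] and [v'] are neither equal nor antipodal;
    - [max (r, r') + alpha] if [v] and [v'] are antipodal.
    Fix a scale [a] in [[alpha, beta]]. Over each base point [(a, y)] lie 2(k+1)
    points, at distance exactly [a] from one another except for antipodal pairs,
    which are farther apart: they span a hollow cross-polytope in [Rips X a],
    whose fundamental cycle is [z_y]. Let [sigma_y] be its facet of positive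
    vertices. A point of another fibre is at distance greater than [a] from
    every point of the fibre of [(a, y)] with a different vertex, because the
    [delta] term is then positive; since [sigma_y] has at least two vertices, no
    such point can be added to it, and neither can a negative vertex, which is
    antipodal to a positive one ([maximal_cross_facet]). Letting [y] run over
    [[0, 1]] gives uncountably many cycles for one value of [a], and the
    coordinate [r] provides such a family for all values of [a] at once.

    The fundamental cycle is an iterated suspension: cone off by the two
    vertices of the next antipodal pair and subtract ([cross]). *)

Set Implicit Arguments.
Unset Strict Implicit.
Unset Printing Implicit Defensive.

Import Order.TTheory GRing.Theory Num.Theory.
Import numFieldTopology.Exports.

Local Open Scope fset_scope.
Local Open Scope classical_set_scope.
Local Open Scope ring_scope.

(** * Chains and cones *)

(** Locked, as are the operators built from it below: when two chains differ,
    comparing them must not unfold the sums over their supports. *)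
HB.lock Definition linext (F : fieldType) (K : choiceType) (V : lmodType F)
  (f : K -> V) (c : {malg F[K]}) : V := \sum_(s <- msupp c) c@_s *: f s.

Section LinearExtension.
Variables (F : fieldType) (K : choiceType) (V : lmodType F) (f : K -> V).
Implicit Type c : {malg F[K]}.
Local Notation linext := (linext f).

Lemma linextEw (d : {fset K}) c : (msupp c `<=` d)%fset ->
  linext c = \sum_(s <- d) c@_s *: f s.
Proof.
move=> cd; rewrite linext.unlock (big_fset_incl _ cd)// => s _ sc.
by rewrite mcoeff_outdom// scale0r.
Qed.

Fact linext_is_linear : linear linext.
Proof.
move=> a c d; pose D := (msupp (a *: c + d) `|` (msupp c `|` msupp d))%fset.
rewrite (@linextEw D (a *: c + d)) ?fsubsetUl//.
rewrite (@linextEw D c); last first.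
  by rewrite (fsubset_trans (fsubsetUl _ (msupp d)))// fsubsetUr.
rewrite (@linextEw D d); last first.
  by rewrite (fsubset_trans (fsubsetUr (msupp c) _))// fsubsetUr.
rewrite scaler_sumr -big_split/=; apply: eq_bigr => s _.
by rewrite mcoeffD mcoeffZ scalerDl scalerA.
Qed.

HB.instance Definition _ :=
  GRing.isLinear.Build F {malg F[K]} V _ linext linext_is_linear.

Lemma linextU s : linext << s >> = f s.
Proof.
rewrite (@linextEw [fset s]%fset) ?msuppU_le//.
by rewrite big_seq_fset1 mcoeffU eqxx scale1r.
Qed.

End LinearExtension.

Lemma eq_linear_on_msupp (F : fieldType) (K : choiceType) (V : lmodType F)
    (g h : {linear {malg F[K]} -> V}) (c : {malg F[K]}) :
  (forall s, s \in msupp c -> g << s >> = h << s >>) -> g c = h c.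
Proof.
have E : c = \sum_(s <- msupp c) c@_s *: << s >>.
  rewrite {1}(monalgE c); apply: eq_bigr => s _.
  by apply/malgP => t; rewrite mcoeffZ !mcoeffU mulr_natr.
move=> gh; rewrite {1 2}E !linear_sum big_seq [RHS]big_seq.
by apply: eq_bigr => s /gh gs; rewrite !linearZ gs.
Qed.

Section VertexPosition.
Variable T : choiceType.
Implicit Types (x y : T) (s : {fset T}).

Let lt x y := (x != y) && vertex_order x y.

Lemma vertex_lt_asym x y : x != y -> lt y x = ~~ lt x y.
Proof.
move=> xy; rewrite /lt xy eq_sym xy/=; apply/idP/idP.
  by move=> yx; apply: contra xy => xy; apply/eqP/vertex_order_antisym/andP.
by have /orP[->//|->] := vertex_order_total x y.
Qed.

Lemma vertex_posU1 s x y : x \notin s -> x != y ->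
  vertex_pos (x |` s)%fset y = (lt x y + vertex_pos s y)%N.
Proof.
move=> xs xy; rewrite /vertex_pos (cardfsD1 x) !inE eqxx/=.
congr (_ + #|` _|)%N; apply/fsetP => z; rewrite !inE.
by case: (eqVneq z x) => [->|]; rewrite ?(negbTE xs)/=.
Qed.

Lemma vertex_pos_self s x : x \notin s -> vertex_pos (x |` s)%fset x = vertex_pos s x.
Proof.
move=> xs; rewrite /vertex_pos; congr #|` _|.
apply/fsetP => z; rewrite !inE.
by case: (eqVneq z x) => [->|]; rewrite ?(negbTE xs)/=.
Qed.

(** The sign rule behind every cone formula: exactly one of [x] and [y] precedes
    the other, so removing them in the two possible orders gives opposite
    signs. *)
Lemma sign_vertex_pos_swap (F : fieldType) s x y :
    x \notin s -> y \notin s -> x != y ->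
  (-1) ^+ (vertex_pos (x |` (y |` s))%fset y + vertex_pos (x |` (y |` s))%fset x)
  = - (-1) ^+ (vertex_pos (y |` s)%fset y + vertex_pos (x |` s)%fset x) :> F.
Proof.
move=> xs ys xy.
have xys : x \notin (y |` s)%fset by rewrite !inE negb_or xy.
rewrite !vertex_pos_self// (vertex_posU1 xys xy) vertex_pos_self//.
rewrite (@vertex_posU1 s y x)// 1?eq_sym// (vertex_lt_asym xy).
by case: lt => /=; rewrite ?add0n ?add1n ?addSn ?addnS exprS mulN1r.
Qed.

End VertexPosition.

(** The boundary of augmented chains, where a vertex has the empty face. It makes
    the cone formula hold in every dimension, down to the empty simplex. *)
Definition aug_simplex_boundary (F : fieldType) (T : choiceType) (s : {fset T}) :
    {malg F[{fset T}]} :=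
  \sum_(x <- s) (-1) ^+ vertex_pos s x *: << (s `\ x)%fset >>.

HB.lock Definition aug_boundary (F : fieldType) (T : choiceType)
    (c : {malg F[{fset T}]}) : {malg F[{fset T}]} :=
  linext (@aug_simplex_boundary F T) c.

(** The sign is that of the face opposite to the apex [n], so that this face
    occurs with coefficient 1 in the boundary of the cone. *)
Definition cone_simplex (F : fieldType) (T : choiceType) (n : T) (s : {fset T}) :
    {malg F[{fset T}]} :=
  (-1) ^+ vertex_pos (n |` s)%fset n *: << (n |` s)%fset >>.

HB.lock Definition cone (F : fieldType) (T : choiceType) (n : T)
    (c : {malg F[{fset T}]}) : {malg F[{fset T}]} :=
  linext (cone_simplex F n) c.

Section Cone.
Variables (F : fieldType) (T : choiceType).
Local Notation chain := {malg F[{fset T}]}.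
Implicit Types (x n : T) (s t : {fset T}) (c d : chain).

Fact aug_boundary_is_linear : linear (@aug_boundary F T).
Proof. by move=> a c d; rewrite aug_boundary.unlock linearP. Qed.

HB.instance Definition _ :=
  GRing.isLinear.Build F chain chain _ _ aug_boundary_is_linear.

Lemma aug_boundaryU s : aug_boundary << s >> = aug_simplex_boundary F s.
Proof. by rewrite aug_boundary.unlock linextU. Qed.

Fact cone_is_linear n : linear (@cone F T n).
Proof. by move=> a c d; rewrite cone.unlock linearP. Qed.

HB.instance Definition _ n :=
  GRing.isLinear.Build F chain chain _ _ (cone_is_linear n).

Lemma coneU n s : cone n << s >> = cone_simplex F n s.
Proof. by rewrite cone.unlock linextU. Qed.

Lemma aug_boundaryB c d :
  aug_boundary (c - d) = aug_boundary c - aug_boundary d.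
Proof. exact: linearB. Qed.

Lemma boundary_aug c : (forall s, s \in msupp c -> (2 <= #|` s|)%N) ->
  boundary c = aug_boundary c.
Proof.
move=> c2; rewrite aug_boundary.unlock linext.unlock.
apply: eq_big_seq => s /c2 s2; congr (_ *: _).
rewrite /simplex_boundary /aug_simplex_boundary big_seq_cond [RHS]big_seq.
apply: eq_bigl => x; case: (boolP (x \in s)) => //= xs.
by rewrite -cardfs_gt0; move: s2; rewrite (cardfsD1 x) xs.
Qed.

Lemma cone0 n : cone n (0 : chain) = 0.
Proof. exact: linear0. Qed.

Definition avoids n c := forall s, s \in msupp c -> n \notin s.

(** Coning is a contracting homotopy: the face opposite to the apex gives [c],
    and the other faces are the cones over the faces of [c]. *)
Lemma aug_boundary_cone n c : avoids n c ->
  aug_boundary (cone n c) = c - cone n (aug_boundary c).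
Proof.
move=> nc.
pose g : {linear chain -> chain} := @aug_boundary F T \o @cone F T n.
pose h : {linear chain -> chain} := idfun \- (@cone F T n \o @aug_boundary F T).
apply: (@eq_linear_on_msupp _ _ _ g h) => s /nc.
rewrite /g /h /= => ns; rewrite coneU aug_boundaryU linearZ/= aug_boundaryU.
rewrite /aug_simplex_boundary big_fsetU1//= scalerDr; congr (_ + _).
  rewrite scalerA -exprD addnn -signr_odd odd_double scale1r.
  congr << _ >>; apply/fsetP => z; rewrite !inE.
  by case: eqVneq => // ->; rewrite (negbTE ns).
rewrite scaler_sumr [cone _ _]linear_sum/= -sumrN big_seq [RHS]big_seq.
apply: eq_bigr => x xs; rewrite [cone _ _]linearZ/= coneU /cone_simplex !scalerA -!exprD.
have nx : n != x by apply: contraNneq ns => ->.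
have Ex : ((n |` s) `\ x = n |` (s `\ x))%fset.
  by apply/fsetP => z; rewrite !inE; case: (eqVneq z n) => // ->; rewrite nx.
rewrite Ex -scaleNr; set a := (X in X *: _ = _); set b := (X in _ = X *: _).
suff -> : a = b by []; rewrite {}/a {}/b.
have := @sign_vertex_pos_swap _ F (s `\ x)%fset n x.
by rewrite fsetD1K// addnC => ->//; rewrite !inE ?eqxx ?negb_and ?ns ?orbT.
Qed.

Lemma mcoeff_cone n c t : avoids n c ->
  (cone n c)@_t =
    if n \in t then (-1) ^+ vertex_pos t n * c@_(t `\ n)%fset else 0.
Proof.
move=> nc; rewrite cone.unlock linext.unlock raddf_sum/= big_seq.
under eq_bigr => s _ do rewrite scalerA mcoeffZ mcoeffU.
case: ifPn => nt; last first.
  rewrite big1// => s _; case: eqVneq => [E|_]; last by rewrite mulr0n !mulr0.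
  by rewrite -E !inE eqxx in nt.
rewrite -big_seq; case: (boolP ((t `\ n)%fset \in msupp c)) => [tc|].
  rewrite (big_fsetD1 _ tc)/= fsetD1K// eqxx mulr1 mulrC big_seq big1 ?addr0//.
  move=> s; rewrite !inE => /andP[st sc]; case: eqVneq => [E|_]; last by rewrite mulr0n !mulr0.
  by case/eqP: st; rewrite -E fsetU1K// nc.
move=> tc; rewrite [in RHS]mcoeff_outdom// mulr0 big_seq big1// => s sc.
case: eqVneq => [E|_]; last by rewrite mulr0n !mulr0.
by case/negP: tc; rewrite -E fsetU1K// nc.
Qed.

Lemma msupp_cone n c t : avoids n c -> t \in msupp (cone n c) ->
  n \in t /\ (t `\ n)%fset \in msupp c.
Proof.
move=> nc; rewrite -mcoeff_neq0 mcoeff_cone//; case: ifP; last by rewrite eqxx.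
by move=> _ H; split=> //; rewrite -mcoeff_neq0; apply: contraNneq H => ->; rewrite mulr0.
Qed.

End Cone.

(** * The fundamental cycle of a cross-polytope *)

Section CrossPolytope.
Variables (F : fieldType) (T : choiceType) (w : nat -> bool -> T) (N : nat).
Local Notation chain := {malg F[{fset T}]}.

(** The fundamental cycle of the boundary of the cross-polytope with antipodal
    pairs [w i true], [w i false] for [i < m]. Starting from the empty simplex,
    each step suspends the previous sphere. *)
Fixpoint cross (m : nat) : chain :=
  if m is m'.+1 then cone (w m' true) (cross m') - cone (w m' false) (cross m')
  else << fset0 >>.

Definition facet (m : nat) : {fset T} := [fset w i true | i in iota 0 m]%fset.

Hypothesis w_inj : forall i j b c, (i < N)%N -> (j < N)%N ->
  w i b = w j c -> i = j /\ b = c.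

(** The simplices of the cycle are transversals: they pick exactly one vertex in
    each antipodal pair. *)
Lemma msupp_cross m s : (m <= N)%N -> s \in msupp (cross m) ->
  [/\ #|` s| = m,
      forall u, u \in s -> exists2 i, (i < m)%N & exists b, u = w i b &
      forall i, (i < m)%N -> w i true \in s -> w i false \in s -> False].
Proof.
elim: m s => [|m IH] s mN /=.
  move=> /(fsubsetP msuppU_le); rewrite inE => /eqP ->.
  by split=> //; rewrite ?cardfs0// => u; rewrite inE.
have av b : avoids (w m b) (cross m).
  move=> t /(IH t (ltnW mN))[_ tw _]; apply/negP => /tw[i im [c]].
  by case/(w_inj mN (ltn_trans im mN)) => mi _; rewrite -mi ltnn in im.
move=> sz.
have [b [bs sm]] : exists b, w m b \in s /\ (s `\ w m b)%fset \in msupp (cross m).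
  have := fsubsetP (msuppB_le _ _) s sz.
  by rewrite inE => /orP[] /(msupp_cone (av _))[]; [exists true|exists false].
have [sm1 sm2 sm3] := IH _ (ltnW mN) sm; split.
- by rewrite (cardfsD1 (w m b)) bs sm1 add1n.
- move=> u us; case: (eqVneq u (w m b)) => [->|ub]; first by exists m => //; exists b.
  have [|i im [c uc]] := sm2 u; first by rewrite !inE ub.
  by exists i; [exact: ltnW|exists c].
- move=> i; rewrite ltnS leq_eqVlt => /orP[/eqP ->|im] it if_.
    (* The vertex antipodal to the apex would lie in the previous sphere. *)
    have : w m (~~ b) \in (s `\ w m b)%fset.
      rewrite !inE; apply/andP; split; last by case: (b).
      by apply/eqP => /(w_inj mN mN)[_]; case: (b).
    by move/sm2 => [j jm [c /(w_inj mN (ltn_trans jm mN))[E _]]]; rewrite -E ltnn in jm.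
  have iN := ltn_trans im mN.
  by apply: (sm3 i im); rewrite !inE ?it ?if_ andbT;
    apply/eqP => /(w_inj iN mN)[E _]; rewrite E ltnn in im.
Qed.

Lemma cross_avoids m b : (m < N)%N -> avoids (w m b) (cross m).
Proof.
move=> mN s /(msupp_cross (ltnW mN))[_ sw _]; apply/negP => /sw[i im [c]].
by case/(w_inj mN (ltn_trans im mN)) => mi _; rewrite -mi ltnn in im.
Qed.

(** The two cones have the same boundary, namely the cycle that is suspended. *)
Lemma aug_boundary_cross m : (m <= N)%N -> aug_boundary (cross m) = 0.
Proof.
elim: m => [|m IH] mN.
  by rewrite aug_boundaryU /aug_simplex_boundary big_seq_fset0.
rewrite [cross _]/(cone (w m true) (cross m) - cone (w m false) (cross m)).
rewrite aug_boundaryB.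
rewrite (aug_boundary_cone (cross_avoids true mN)).
rewrite (aug_boundary_cone (cross_avoids false mN)).
by rewrite (IH (ltnW mN)) !cone0 subr0 subrr.
Qed.

Lemma mem_facet m u : reflect (exists2 i, (i < m)%N & u = w i true) (u \in facet m).
Proof.
apply: (iffP (imfsetP _ _ _ _)) => -[i]; rewrite ?inE ?mem_iota => im ->.
  by exists i; rewrite ?mem_iota in im *.
by exists i; rewrite ?inE ?mem_iota.
Qed.

Lemma mcoeff_cross_facet m : (m <= N)%N -> (cross m)@_(facet m) != 0.
Proof.
elim: m => [|m IH] mN.
  rewrite (_ : facet 0 = fset0) ?[_@_ _]mcoeffUU ?oner_neq0//.
  by apply/fsetP => u; rewrite inE; apply/negP => /mem_facet[].
have wm : w m true \in facet m.+1 by apply/mem_facet; exists m.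
have wm' : w m false \notin facet m.+1.
  by apply/negP => /mem_facet[i im /(w_inj mN (leq_trans im mN))[]].
rewrite [cross _]/(cone (w m true) (cross m) - cone (w m false) (cross m)).
rewrite mcoeffB (mcoeff_cone _ (cross_avoids true mN)).
rewrite (mcoeff_cone _ (cross_avoids false mN)).
rewrite wm (negbTE wm') subr0 mulf_neq0 ?signr_eq0//.
suff -> : (facet m.+1 `\ w m true)%fset = facet m by apply/IH/ltnW.
apply/fsetP => u; rewrite !inE; apply/andP/mem_facet.
  move=> [um /mem_facet[i im ui]]; exists i => //.
  move: im; rewrite ltnS leq_eqVlt => /orP[/eqP im|//].
  by rewrite ui im eqxx in um.
move=> [i im ui]; split; last by apply/mem_facet; exists i => //; exact: ltnW.
by apply/eqP; rewrite ui => /(w_inj (ltn_trans im mN) mN)[E]; rewrite E ltnn in im.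
Qed.

End CrossPolytope.

(** * Uncountable dimension from an independent family *)

Section BasisExtension.
Variables (F : fieldType) (V : lmodType F).
Implicit Types (A B : set V) (s : {fset V}).

Lemma fset_sub_chain A (C : set (set V)) s :
    C !=set0 -> total_on C subset ->
    [set` s] `<=` A `|` \bigcup_(X in C) X ->
  exists2 X, C X & [set` s] `<=` A `|` X.
Proof.
move=> [X0 CX0] Ctot.
elim/fset1U_rect: s => [|x s xs IH] sC; first by exists X0.
have [|X CX sX] := IH.
  by apply: subset_trans sC => y /= ys; rewrite !inE ys orbT.
have [Y CY xY] : exists2 Y, C Y & (A `|` Y) x.
  have [|Ax|[Y CY Yx]] := sC x; first by rewrite /= !inE eqxx.
    by exists X0 => //; left.
  by exists Y => //; right.
have [XY|YX] := Ctot _ _ CX CY; [exists Y => // | exists X => //] => y /=;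
  rewrite !inE => /orP[/eqP ->//|/sX].
- by case=> [?|/XY]; [left|right].
- by case: xY => [?|/YX]; [left|right].
- by [].
Qed.

Lemma linearly_independent_spanned B v : linearly_independent B ->
    ~ linearly_independent (v |` B) ->
  exists s (c : V -> F), [set` s] `<=` B /\ v = \sum_(w <- s) c w *: w.
Proof.
move=> Bfree; apply: contra_notP => /forallNP nspan s c sB E w ws.
apply/eqP/negPn/negP => cw0.
have [vs|vs] := boolP (v \in s); last first.
  case/eqP: cw0; apply: (Bfree s c) => // u us.
  by case: (sB u us) => // uv; rewrite -uv us in vs.
have svB : [set` (s `\ v)%fset] `<=` B.
  move=> u /=; rewrite !inE => /andP[uv us].
  by case: (sB u us) => // /eqP; rewrite (negbTE uv).
rewrite (big_fsetD1 v)//= in E.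
have cv0 : c v = 0.
  apply/eqP/negPn/negP => cv; case: (nspan (s `\ v)%fset).
  exists (fun w => - (c v)^-1 * c w); split=> //.
  under eq_bigr do rewrite -scalerA; rewrite -scaler_sumr.
  move/eqP: E; rewrite addr_eq0 => /eqP E.
  by apply: (scalerI cv); rewrite E scalerA mulrN mulfV// scaleN1r.
rewrite cv0 scale0r add0r in E.
have [wv|wv] := eqVneq w v; first by rewrite wv cv0 eqxx in cw0.
by case/eqP: cw0; apply: (Bfree (s `\ v)%fset c) => //; rewrite !inE wv.
Qed.

(** Zorn's lemma is applied to the sets [B] such that [A `|` B] is independent,
    rather than to the independent sets containing [A], so that the empty chain
    also has an upper bound satisfying the condition. *)
Lemma independent_extends_to_basis A : linearly_independent A ->
  exists2 B, A `<=` B & is_basis B.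
Proof.
move=> Afree.
pose P B := linearly_independent (A `|` B).
have [|B [PB Bmax]] := @Zorn_bigcup V P.
  move=> C CP Ctot s c sC.
  have [C0|C0] := pselect (C !=set0).
    by have [X /CP PX sX] := fset_sub_chain C0 Ctot sC; exact: PX.
  apply: Afree => x /sC[//|[X CX]]; by case: C0; exists X.
exists (A `|` B); first by move=> x; left.
split=> // v.
have [Bv|nBv] := pselect ((A `|` B) v).
  exists [fset v]%fset, (fun=> 1); split; last by rewrite big_seq_fset1 scale1r.
  by move=> w /=; rewrite inE => /eqP ->.
apply: linearly_independent_spanned => // vB.
apply: (Bmax (v |` B)); last by rewrite /P setUCA.
split; first by move=> x; right.
by move=> vBB; apply: nBv; right; apply: vBB; left.
Qed.

Lemma uncountable_dimension_of_independent (I : Type) (h : I -> V) :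
    ~ countable [set: I] -> injective h -> linearly_independent (range h) ->
  uncountable_dimension V.
Proof.
move=> Iunc hinj /independent_extends_to_basis[B hB Bbasis].
exists B; split=> //; apply: contra_not Iunc => Bc.
rewrite -(eq_countable (inj_card_eq (A := setT) (in2W hinj))).
by apply: sub_countable Bc; exact: subset_card_le.
Qed.

End BasisExtension.

(** * Maximal simplices detect homology classes *)

Section MaximalSimplices.
Variables (F : fieldType) (T : choiceType) (S : simplicial_complex T) (k : nat).
Local Notation chain := {malg F[{fset T}]}.

Definition maximal_simplex (s : {fset T}) :=
  forall t, simplex S t -> (s `<=` t)%fset -> t = s.

(** A simplex occurring in a boundary is a proper face of another simplex. *)
Lemma mcoeff_boundary_maximal n s (b : chain) :
  maximal_simplex s -> b \in chains S n -> (boundary b)@_s = 0.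
Proof.
move=> smax /asboolP bS; rewrite /boundary raddf_sum/= big_seq big1// => t tb.
rewrite mcoeffZ /simplex_boundary raddf_sum/= big_seq_cond big1 ?mulr0// => x.
move=> /andP[xt _]; rewrite mcoeffZ mcoeffU.
case: eqVneq => [E|_]; last by rewrite mulr0n mulr0.
have /(smax _ (bS t tb).1) ts : (s `<=` t)%fset by rewrite -E fsubD1set.
by move/fsetP/(_ x): E; rewrite -ts !inE eqxx xt.
Qed.

Lemma mcoeff_null_homologous s (z : cycles F S k) :
  maximal_simplex s -> quot_pi (@boundaries_submod_closed F T S k) z = 0 ->
  (val z)@_s = 0.
Proof.
move=> smax /eqP; rewrite quot_pi_eq0 => /asboolP[b bS ->].
by apply: mcoeff_boundary_maximal bS.
Qed.

(** The coefficients on the [sigma i] are linear forms on homology, dual to the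
    classes of the [z i] up to nonzero scalars; so these classes are distinct
    and independent. *)
Lemma uncountable_dimension_homology (I : choiceType)
    (z : I -> chain) (sigma : I -> {fset T}) :
    ~ countable [set: I] -> (forall i, z i \in is_cycle S k) ->
    (forall i, maximal_simplex (sigma i)) ->
    (forall i, (z i)@_(sigma i) != 0) ->
    (forall i j, i != j -> (z j)@_(sigma i) = 0) ->
  uncountable_dimension (homology F S k).
Proof.
move=> Iunc zcyc smax zs0 zs; pose cl i : cycles F S k := Cycle (zcyc i).
pose h i : homology F S k := quot_pi (@boundaries_submod_closed F T S k) (cl i).
apply: (uncountable_dimension_of_independent (h := h)) => //.
  move=> i j hij; apply/eqP/negPn/negP => ij.
  have : (val (cl i - cl j))@_(sigma i) = 0.
    apply: mcoeff_null_homologous => //; apply/eqP.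
    by rewrite linearB subr_eq0; apply/eqP.
  by rewrite raddfB/= (zs i j)// subr0 => /eqP; apply/negP.
move=> s c sh E v vs; have [i0 _ _] := sh v vs.
have /choice[g gP] u : exists i, u \in s -> h i = u.
  by have [us|_] := boolP (u \in s); [have [i _ iu] := sh u us; exists i|exists i0].
have : (val (\sum_(u <- s) c u *: cl (g u)))@_(sigma (g v)) = 0.
  apply: mcoeff_null_homologous => //; rewrite linear_sum -[RHS]E.
  apply: eq_big_seq => u us; transitivity (c u *: h (g u)); last by rewrite gP.
  exact: linearZ.
rewrite !raddf_sum/= (big_fsetD1 v)//= big_seq big1 => [|u].
  rewrite addr0 mcoeffZ => /eqP.
  by rewrite mulf_eq0 (negbTE (zs0 _)) orbF => /eqP.
rewrite in_fsetD1 => /andP[uv us]; rewrite mcoeffZ (zs (g v) (g u)) ?mulr0//.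
by apply: contraNneq uv => E'; rewrite -(gP u us) -(gP v vs) E'.
Qed.

End MaximalSimplices.

(** * The metric space *)

(** Countable sets have Lebesgue measure zero. *)
Lemma unit_interval_uncountable (R : realType) :
  ~ countable [set: {y : R | 0 <= y <= 1}].
Proof.
move=> uI.
have : countable `[0, 1 : R]%classic.
  apply: (@sub_countable _ _ _ (range (sval : {y : R | 0 <= y <= 1} -> R))); last first.
    by apply: card_le_trans uI; exact: card_image_le.
  apply: subset_card_le => y; rewrite /= in_itv/= => y01.
  by exists (exist _ y y01).
move/lebesgue_measure.countable_lebesgue_measure0.
rewrite lebesgue_measure.lebesgue_measure_itv /=.
by rewrite constructive_ereal.lte_fin ltr01 => -[/eqP]; rewrite subr0 oner_eq0.
Qed.

Section Clamp.
Variable R : realType.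
Implicit Types a b x y : R.

Definition clamp a b x : R := Num.max a (Num.min x b).

Lemma clamp_itv a b x : a <= b -> a <= clamp a b x <= b.
Proof. by move=> ab; rewrite /clamp le_max lexx ge_max ab ge_min lexx orbT. Qed.

Lemma clamp_id a b x : a <= x <= b -> clamp a b x = x.
Proof. by move=> /andP[ax xb]; rewrite /clamp min_l// max_r. Qed.

Lemma clamp_dist a b x y : `|clamp a b x - clamp a b y| <= `|x - y|.
Proof.
have [xy1 xy2] : x - y <= `|x - y| /\ - (x - y) <= `|x - y|.
  by split; [exact: ler_norm | rewrite -normrN; exact: ler_norm].
rewrite ler_norml /clamp; case: (leP x b) => xb; case: (leP y b) => yb;
  case: (leP a x) => ax; case: (leP a y) => ay; case: (leP a b) => ab; lra.
Qed.

End Clamp.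

Section CrossSpace.
Variables (R : realType) (alpha : {posnum R}) (beta : R) (k : nat).

Definition cross_space : Type :=
  {r : R | alpha%:num <= r <= beta} * {y : R | 0 <= y <= 1} * ('I_k.+1 * bool).
HB.instance Definition _ := Choice.on cross_space.

Implicit Types p q r : cross_space.

Definition scale p : R := val p.1.1.
Definition param p : R := val p.1.2.
Definition corner p : 'I_k.+1 * bool := p.2.

(** The part of the distance that depends on the vertices. In the first case it
    must be at least [|scale p - scale q|]: moving along a copy of the base
    changes the maximum in the second case by up to that amount, on top of the
    change of the base distance. *)
Definition gap p q : R :=
  if corner p == corner q then `|scale p - scale q|
  else Num.max (scale p) (scale q) +
    (if (corner p).1 == (corner q).1 then alpha%:num else 0).

Definition cross_dist p q : R :=
  `|scale p - scale q| + `|param p - param q| + gap p q.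

Lemma scale_ge p : alpha%:num <= scale p.
Proof. by rewrite /scale; case: p.1.1 => x /= /andP[]. Qed.

Lemma scale_gt0 p : 0 < scale p.
Proof. exact: lt_le_trans (scale_ge p). Qed.

Lemma eq_cross_space p q :
  scale p = scale q -> param p = param q -> corner p = corner q -> p = q.
Proof.
by move: p q => [[? ?] ?] [[? ?] ?] /val_inj /= -> /val_inj /= -> ->.
Qed.

Lemma gap_ge0 p q : 0 <= gap p q.
Proof.
rewrite /gap; case: ifP => _; first exact: normr_ge0.
rewrite addr_ge0//; first by rewrite le_max ltW ?scale_gt0.
by case: ifP.
Qed.

Lemma cross_dist_self p : cross_dist p p = 0.
Proof. by rewrite /cross_dist /gap eqxx !subrr normr0 !addr0. Qed.

Lemma cross_dist_sym p q : cross_dist p q = cross_dist q p.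
Proof.
rewrite /cross_dist /gap distrC (distrC (param p)) maxC.
by rewrite (eq_sym (corner p)) (eq_sym (corner p).1).
Qed.

(** With equal outer vertices, use [|x - z| <= max x z]; with exactly one repeated
    consecutive vertex, use that [max] is 1-Lipschitz; with three distinct
    vertices, the sum of the two maxima exceeds [max (scale p) (scale r)] by at
    least [alpha], a lower bound of [scale], which pays for an antipodal outer
    pair. *)
Lemma gap_triangle q p r : gap p r <= gap p q + gap q r.
Proof.
have := scale_ge p; have := scale_ge q; have := scale_ge r.
have a0 : 0 < alpha%:num by [].
have max_ge (x y : R) : x <= Num.max x y /\ y <= Num.max x y.
  by split; rewrite le_max lexx ?orbT.
have abs_ge (x : R) : x <= `|x| /\ - x <= `|x|.
  by split; [exact: ler_norm | rewrite -normrN; exact: ler_norm].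
have [pq1 pq2] := max_ge (scale p) (scale q).
have [qr1 qr2] := max_ge (scale q) (scale r).
have [pq3 pq4] := abs_ge (scale p - scale q).
have [qr3 qr4] := abs_ge (scale q - scale r).
rewrite /gap; move: (corner p) (corner q) (corner r) => u v w ra qa pa.
have [<-|uv] := eqVneq u v.
  have [_|uw] := eqVneq u w; first by rewrite ler_norml; lra.
  suff : Num.max (scale p) (scale r) <=
    `|scale p - scale q| + Num.max (scale q) (scale r) by lra.
  by rewrite ge_max; lra.
have [<-|vw] := eqVneq v w.
  rewrite (negbTE uv).
  suff : Num.max (scale p) (scale r) <=
    Num.max (scale p) (scale q) + `|scale q - scale r| by lra.
  by rewrite ge_max; lra.
have [_|uw] := eqVneq u w.
  by rewrite ler_norml; case: ifP; case: ifP; lra.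
suff : Num.max (scale p) (scale r) + alpha%:num <=
    Num.max (scale p) (scale q) + Num.max (scale q) (scale r).
  by do 3 case: ifP => _; lra.
by rewrite -lerBrDr ge_max; lra.
Qed.

Lemma cross_dist_triangle q p r :
  cross_dist p r <= cross_dist p q + cross_dist q r.
Proof.
rewrite /cross_dist; have := gap_triangle q p r.
have := ler_distD (scale q) (scale p) (scale r).
have := ler_distD (param q) (param p) (param r).
lra.
Qed.

Lemma cross_dist_positivity p q : cross_dist p q = 0 -> p = q.
Proof.
have := gap_ge0 p q; have := normr_ge0 (scale p - scale q).
have := normr_ge0 (param p - param q); rewrite /cross_dist => y0 s0 g0 d0.
have gE : gap p q = 0 by lra.
apply: eq_cross_space.
- by apply/eqP; rewrite -subr_eq0 -normr_eq0; apply/eqP; lra.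
- by apply/eqP; rewrite -subr_eq0 -normr_eq0; apply/eqP; lra.
- apply/eqP; move: gE; rewrite /gap; case: ifP => // _.
  have : scale p <= Num.max (scale p) (scale q) by rewrite le_max lexx.
  have := scale_gt0 p; have a0 : 0 < alpha%:num by [].
  by case: ifP => _; lra.
Qed.

HB.instance Definition _ := @isMetric.Build R cross_space cross_dist
  cross_dist_self cross_dist_positivity cross_dist_sym cross_dist_triangle.

(** Once the vertices differ, the maximum alone uses up the allowed distance
    [scale p], so the base distance and the antipodal penalty must vanish. This
    is what isolates each fibre from its neighbours at its own scale. *)
Lemma cross_dist_le_scale p q : corner p != corner q ->
  cross_dist p q <= scale p -> p.1 = q.1 /\ (corner p).1 != (corner q).1.
Proof.
move=> pq; rewrite /cross_dist /gap (negbTE pq).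
have : scale p <= Num.max (scale p) (scale q) by rewrite le_max lexx.
have := normr_ge0 (scale p - scale q).
have := normr_ge0 (param p - param q); have a0 : 0 < alpha%:num by [].
case: ifP => _ y0 s0 m0 d0; first by exfalso; lra.
split=> //.
have /eqP : `|scale p - scale q| = 0 by lra.
have /eqP : `|param p - param q| = 0 by lra.
rewrite !normr_eq0 !subr_eq0 => /eqP yE /eqP sE.
move: yE sE; rewrite /scale /param.
by case: p.1 q.1 => [s y] [s' y'] /= /val_inj -> /val_inj ->.
Qed.

Lemma cross_dist_neighbours p q : p.1 = q.1 ->
  (corner p).1 != (corner q).1 -> cross_dist p q = scale p.
Proof.
move=> pq cpq; have sE : scale p = scale q by rewrite /scale pq.
have yE : param p = param q by rewrite /param pq.
have cE : corner p != corner q by apply: contra_neq cpq => ->.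
by rewrite /cross_dist /gap (negbTE cE) (negbTE cpq) sE yE !subrr normr0 maxxx !add0r addr0.
Qed.

Hypothesis alpha_le_beta : alpha%:num <= beta.

(** Clamping extends the inclusion of a copy of the base to a continuous map on
    the whole plane, so that the copy is the image of a compact rectangle. *)
Definition cross_chart (c : 'I_k.+1 * bool) (xy : R * R) : cross_space :=
  (exist _ (clamp alpha%:num beta xy.1) (clamp_itv xy.1 alpha_le_beta),
   exist _ (clamp 0 1 xy.2) (clamp_itv xy.2 ler01), c).

(** The distance between the images of [(r, y)] and [(r', y')] is at most
    [2 |r - r'| + |y - y'|], hence the radius [e / 3]. *)
Lemma cross_chart_continuous c : continuous (cross_chart c).
Proof.
move=> xy; apply/metricType_numDomainType.cvgrPdist_lt => e e0.
have e30 : 0 < e / 3 by rewrite divr_gt0.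
apply: filterS (nbhsx_ballx xy (PosNum e30)%:num e30) => -[x y] [bx by_].
rewrite [mdist _ _]/(cross_dist _ _) /cross_dist /gap eqxx /scale /param /=.
have := clamp_dist alpha%:num beta xy.1 x; have := clamp_dist 0 1 xy.2 y.
have x_near : `|xy.1 - x| < e / 3 := bx.
have y_near : `|xy.2 - y| < e / 3 := by_.
lra.
Qed.

Lemma cross_space_compact : compact [set: cross_space].
Proof.
have -> : [set: cross_space] = \big[setU/set0]_(c : 'I_k.+1 * bool)
    (cross_chart c @` (`[alpha%:num, beta] `*` `[0, 1])).
  rewrite -bigcup_seq; apply/seteqP; split=> // -[[[s sab] [y y01]] c] _.
  exists c; first by rewrite /= mem_index_enum.
  exists (s, y); first by split; rewrite /= in_itv.
  by apply: eq_cross_space => //; rewrite /scale /param /= clamp_id.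
apply: bigsetU_compact => c _; apply: continuous_compact.
  exact/continuous_subspaceT/cross_chart_continuous.
apply: compact_setX; exact: normed_module.segment_compact.
Qed.

(** * Cross-polytopes over the points of a given scale *)

Section CrossPolytopes.
Variables (F : fieldType) (s : {r : R | alpha%:num <= r <= beta}).
Hypothesis k_ge1 : (1 <= k)%N.
Implicit Type y : {y : R | 0 <= y <= 1}.

Local Notation X := (cross_space : metricType R).
Local Notation a := (val s).

Definition cross_vertex y (i : nat) (b : bool) : X := (s, y, (inord i, b)).

Lemma cross_vertex_inj y y' i j b c : (i < k.+1)%N -> (j < k.+1)%N ->
  cross_vertex y i b = cross_vertex y' j c -> [/\ y = y', i = j & b = c].
Proof.
move=> ik jk [-> ij ->]; split=> //.
by rewrite -(inordK ik) -(inordK jk) ij.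
Qed.

Lemma cross_vertex_inj_fixed y i j b c : (i < k.+1)%N -> (j < k.+1)%N ->
  cross_vertex y i b = cross_vertex y j c -> i = j /\ b = c.
Proof. by move=> ik jk /(cross_vertex_inj ik jk)[]. Qed.

Lemma cross_cycle y : cross F (cross_vertex y) k.+1 \in is_cycle (Rips X a) k.
Proof.
have inj := @cross_vertex_inj_fixed y.
have supp := @msupp_cross F _ (cross_vertex y) k.+1 inj k.+1 _ (leqnn _).
apply/andP; split.
  apply/asboolP => t /supp[tk tw tf]; split=> //; split.
    by rewrite -cardfs_gt0 tk.
  move=> u v ut vt.
  have [i ik [b uE]] := tw u ut; have [j jk [c vE]] := tw v vt.
  have [ij|ij] := eqVneq i j.
    suff -> : u = v by rewrite mdistxx; exact/ltW/(scale_gt0 (cross_vertex y i b)).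
    rewrite {}uE {}vE -{}ij in ut vt *; congr cross_vertex.
    by case: b c ut vt => -[]// ut vt; case: (tf i ik).
  suff : cross_dist u v <= a by [].
  rewrite cross_dist_neighbours uE ?vE//=.
  by apply: contra_neq ij => ij; rewrite -(inordK ik) -(inordK jk) ij.
rewrite boundary_aug => [|t /supp[-> _ _]]; last by [].
by apply/eqP; apply: (aug_boundary_cross F inj).
Qed.

(** If [u] is adjacent to all vertices of the facet, compare it first with one
    whose index differs from that of [u], which exists as [k >= 1]: this puts
    [u] in the fibre of [y]. The facet vertex of the same index then prevents
    [u] from being a negative vertex. *)
Lemma maximal_cross_facet y :
  maximal_simplex (Rips X a) (facet (cross_vertex y) k.+1).
Proof.
move=> t [_ td] /fsubsetP ft; apply/fsetP => u; apply/idP/idP => [ut|/ft//].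
have vt i : (i < k.+1)%N -> cross_vertex y i true \in t.
  by move=> ik; apply/ft/mem_facet; exists i.
case: u ut => [sy [i b]] ut.
have close (j : 'I_k.+1) c : cross_vertex y j c \in t -> (j, c) != (i, b) ->
    (s, y) = sy /\ j != i.
  move=> jt ji; have cE : corner (cross_vertex y j c) = (j, c).
    by rewrite /corner /= inord_val.
  have := @cross_dist_le_scale (cross_vertex y j c) (sy, (i, b)).
  rewrite cE; apply => //; exact: td.
have [j ji] : exists j : 'I_k.+1, j != i.
  have [->|i0] := eqVneq i ord0; last by exists ord0; rewrite eq_sym.
  by exists ord_max; rewrite -val_eqE /= -lt0n.
have [] := close j true (vt j (ltn_ord j)).
  by apply: contra_neq ji => -[].
move=> syE _; case: b ut close => ut close.
  by apply/mem_facet; exists i => //; rewrite /cross_vertex inord_val syE.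
have [|_] := close i true (vt i (ltn_ord i)); last by rewrite eqxx.
by apply/eqP => -[].
Qed.

Lemma uncountable_dimension_Rips_cross_space :
  uncountable_dimension (homology F (Rips X a) k).
Proof.
have inj := cross_vertex_inj_fixed.
apply: (@uncountable_dimension_homology F X (Rips X a) k _
  (fun y => cross F (cross_vertex y) k.+1)
  (fun y => facet (cross_vertex y) k.+1)).
- exact: unit_interval_uncountable.
- exact: cross_cycle.
- exact: maximal_cross_facet.
- by move=> y; apply: (mcoeff_cross_facet F (inj y)).
move=> y y' yy'; apply: mcoeff_outdom; apply/negP.
move=> /(msupp_cross (inj y') (leqnn _))[_ tw _].
have [|i ik [b]] := tw (cross_vertex y 0 true); first by apply/mem_facet; exists 0%N.
by move=> /(cross_vertex_inj (ltn0Sn _) ik)[E]; rewrite E eqxx in yy'.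
Qed.

End CrossPolytopes.

End CrossSpace.

Theorem proposition5p9 (F : fieldType) (R : realType) (alpha beta : R)
    (alpha_gt0 : 0 < alpha) (alpha_le_beta : alpha <= beta)
    (k : nat) (k_ge1 : (1 <= k)%N) :
  exists X : metricType R, compact [set: X] /\
    forall a : R, alpha <= a <= beta ->
      uncountable_dimension (homology F (Rips X a) k).
Proof.
exists (cross_space (PosNum alpha_gt0) beta k : metricType R); split.
  exact: cross_space_compact.
move=> a ab.
exact: (@uncountable_dimension_Rips_cross_space R (PosNum alpha_gt0) beta k F
  (exist _ a ab)).
Qed.
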